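(* Let $(A,\sigma)$ be a real Hermitian algebra, $G=\mathrm{O}(A_\mathbb{C},\sigma_\mathbb{C})$, $K=\mathrm{O}(A,\sigma)$, and for $g=g_0+g_1i\in G$ with $g_0,g_1\in A$ put $\hat g=\begin{pmatrix} g_0&g_1\\-g_1&g_0\end{pmatrix}$, $\hat G=\{\hat g\mid g\in G\}$, $\hat K=\{\hat g\mid g\in K\}$. Let $$\mathfrak{C}_G=\{J\colon A^2\to A^2\mid b(J(x),J(y))=-b(x,y)\ \text{for all }x,y\in A^2\}\cap\mathfrak{C}_{\mathrm{Aut}(h)}.$$ Then the group $\hat G$ acts on $\mathfrak{C}_G$ by conjugation. This action is transitive, and the stabilizer of $J_0=\begin{pmatrix}0&1\\1&0\end{pmatrix}$ is $\hat K$.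
   Context: $A$ is a unital associative, possibly noncommutative, finite-dimensional semisimple $\mathbb{R}$-algebra and $\sigma\colon A\to A$ is an anti-involution: $\mathbb{R}$-linear, $\sigma(ab)=\sigma(b)\sigma(a)$, $\sigma^2=\mathrm{Id}$. Put $A^\sigma=\{a\in A\mid\sigma(a)=a\}$, $A^\times$ the group of invertible elements, $\mathrm{O}(A,\sigma)=\{a\in A^\times\mid \sigma(a)=a^{-1}\}$, $A^\sigma_+=\{a^2\mid a\in A^\sigma\cap A^\times\}$, $A^\sigma_{\ge 0}=\{a^2\mid a\in A^\sigma\}$. The pair $(A,\sigma)$ is Hermitian if for $x,y\in A^\sigma$, $x^2+y^2=0$ implies $x=y=0$; as standing properties of Hermitian algebras, $A^\sigma_+$ and $A^\sigma_{\ge0}$ are proper convex cones in $A^\sigma$, $\mathrm{O}(A,\sigma)$ is compact, and $x\mapsto ax\sigma(a)$ preserves $A^\sigma_+$ and $A^\sigma_{\geq 0}$ for every $a\in A^\times$. $A_\mathbb{C}=A\otimes_\mathbb{R}\mathbb{C}$, $\sigma_\mathbb{C}$ is the $\mathbb{C}$-linear extension of $\sigma$, and $\mathrm{O}(A_\mathbb{C},\sigma_\mathbb{C})=\{a\in A_\mathbb{C}^\times\mid\sigma_\mathbb{C}(a)=a^{-1}\}$. $A^2$ is the right $A$-module of columns; $x\in A^2$ is regular if there is $y\in A^2$ such that $(a,c)\mapsto xa+yc$ is an isomorphism $A^2\to A^2$ of right $A$-modules; an $A$-line is a submodule $xA$ with $x$ regular. For $x,y\in A^2$ let $h(x,y)=\sigma(x)^t\begin{pmatrix}0&1\\1&0\end{pmatrix}y$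 and $b(x,y)=\sigma(x)^t\begin{pmatrix}-1&0\\0&1\end{pmatrix}y$. A form $\beta\colon A^2\times A^2\to A$ that is biadditive with $\beta(xr_1,yr_2)=\sigma(r_1)\beta(x,y)r_2$ is a $\sigma$-inner product if $\beta(x,y)=\sigma(\beta(y,x))$ for all $x,y$, and for all regular $x$, $\beta(x,x)\in A^\sigma_{\geq0}$, with $\beta(x,x)=0$ if and only if $x=0$. An $A$-linear $J\colon A^2\to A^2$ is an indefinite involutive operator if $J^2=\mathrm{Id}$ and there are two $A$-lines $l_J^+,l_J^-$ with $J|_{l_J^+}=\mathrm{Id}$, $J|_{l_J^-}=-\mathrm{Id}$. $\mathfrak{C}_{\mathrm{Aut}(h)}$ is the set of all indefinite involutive operators $J$ such that $h_J(x,y):=h(J(x),y)$ is a $\sigma$-inner product. *)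

(* Defs.v *)
From HB Require Import structures.
From mathcomp Require Import all_boot all_order all_algebra all_field.
From mathcomp Require Import all_classical all_reals all_analysis.
Set Implicit Arguments.
Unset Strict Implicit.
Unset Printing Implicit Defensive.
Import Order.TTheory GRing.Theory Num.Theory.
Import numFieldNormedType.Exports.
Local Open Scope classical_set_scope.
Local Open Scope ring_scope.

(* A_C = A (x)_R C; [Cplx a b] is a + b i. *)
Record complexification (R : realType) (A : falgType R) : Type :=
  Cplx { re_part : A; im_part : A }.

Section ComplexificationAlgebra.
Import VectorInternalTheory.
Context {R : realType} {A : falgType R}.
Local Notation AC := (complexification A).
Implicit Types (g k : AC) (t : R).

Let to_pair g : A * A := (re_part g, im_part g).
Let of_pair (p : A * A) : AC := Cplx p.1 p.2.
Let to_pairK : cancel to_pair of_pair. Proof. by case. Qed.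

HB.instance Definition _ := Choice.copy AC (can_type to_pairK).

Let czero : AC := Cplx 0 0.
Let copp g : AC := Cplx (- re_part g) (- im_part g).
Let cadd g k : AC := Cplx (re_part g + re_part k) (im_part g + im_part k).
Let cone : AC := Cplx 1 0.
Let cmul g k : AC :=
  Cplx (re_part g * re_part k - im_part g * im_part k)
       (re_part g * im_part k + im_part g * re_part k).
Let cscale t g : AC := Cplx (t *: re_part g) (t *: im_part g).

Let caddA : associative cadd.
Proof. by move=> [a b] [c d] [e f]; congr Cplx; rewrite /= addrA. Qed.
Let caddC : commutative cadd.
Proof. by move=> [a b] [c d]; congr Cplx; rewrite /= addrC. Qed.
Let cadd0 : left_id czero cadd.
Proof. by move=> [a b]; congr Cplx; rewrite /= add0r. Qed.
Let caddN : left_inverse czero copp cadd.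
Proof. by move=> [a b]; congr Cplx; rewrite /= addNr. Qed.

HB.instance Definition _ := GRing.isZmodule.Build AC caddA caddC cadd0 caddN.

Let cmulA : associative cmul.
Proof.
move=> [a b] [c d] [e f]; congr Cplx => /=.
- rewrite !mulrBr !mulrBl !mulrDr !mulrDl !mulrA !opprD !addrA.
  by rewrite addrAC; congr (_ + _); rewrite addrAC.
- rewrite !mulrBr !mulrBl !mulrDr !mulrDl !mulrA !addrA.
  by rewrite addrAC; congr (_ + _); rewrite addrAC.
Qed.
Let cmul1l : left_id cone cmul.
Proof.
by move=> [a b]; congr Cplx; rewrite /= !mul1r !mul0r (subr0, addr0).
Qed.
Let cmul1r : right_id cone cmul.
Proof.
by move=> [a b]; congr Cplx; rewrite /= !mulr1 !mulr0 (subr0, add0r).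
Qed.
Let cmulDl : left_distributive cmul +%R.
Proof.
by move=> [a b] [c d] [e f]; congr Cplx; rewrite /= !mulrDl ?opprD addrACA.
Qed.
Let cmulDr : right_distributive cmul +%R.
Proof.
by move=> [a b] [c d] [e f]; congr Cplx; rewrite /= !mulrDr ?opprD addrACA.
Qed.
Let cone_neq0 : cone != 0.
Proof. by apply/eqP => -[] /eqP; rewrite oner_eq0. Qed.

HB.instance Definition _ := GRing.Zmodule_isNzRing.Build AC
  cmulA cmul1l cmul1r cmulDl cmulDr cone_neq0.

Let cscaleA s t g : cscale s (cscale t g) = cscale (s * t) g.
Proof. by congr Cplx; rewrite /= scalerA. Qed.
Let cscale1 : left_id 1 cscale.
Proof. by move=> [a b]; congr Cplx; rewrite /= scale1r. Qed.
Let cscaleDr : right_distributive cscale +%R.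
Proof. by move=> t [a b] [c d]; congr Cplx; rewrite /= scalerDr. Qed.
Let cscaleDl g : {morph cscale^~ g : s t / s + t}.
Proof. by move=> s t; congr Cplx; rewrite /= scalerDl. Qed.

HB.instance Definition _ := GRing.Zmodule_isLmodule.Build R AC
  cscaleA cscale1 cscaleDr cscaleDl.

Let cscaleAl t g k : t *: (g * k) = (t *: g) * k.
Proof. by congr Cplx; rewrite /= (scalerBr, scalerDr) !scalerAl. Qed.

HB.instance Definition _ := GRing.Lmodule_isLalgebra.Build R AC cscaleAl.

Let cscaleAr t g k : t *: (g * k) = g * (t *: k).
Proof. by congr Cplx; rewrite /= (scalerBr, scalerDr) !scalerAr. Qed.

HB.instance Definition _ := GRing.Lalgebra_isAlgebra.Build R AC cscaleAr.

Let cplx_vect : Vector.axiom (dim A + dim A) AC.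
Proof.
exists (fun g => row_mx (v2r (re_part g)) (v2r (im_part g))).
  move=> t g k; rewrite -[re_part (_ + _)]/(t *: re_part g + re_part k).
  rewrite -[im_part (_ + _)]/(t *: im_part g + im_part k).
  by rewrite !linearP scale_row_mx add_row_mx.
exists (fun w => Cplx (r2v (lsubmx w)) (r2v (rsubmx w))) => [[a b]|w] /=.
  by rewrite row_mxKl row_mxKr !v2rK.
by rewrite !r2vK hsubmxK.
Qed.

HB.instance Definition _ := Lmodule_hasFinDim.Build R AC cplx_vect.
HB.instance Definition _ := Algebra_isFalgebra.Build R AC.

Definition iC : AC := Cplx 0 1.
Definition toC (a : A) : AC := Cplx a 0.

Lemma iC_sqr : iC * iC = -1.
Proof. by congr Cplx; rewrite /= ?(mul0r, mul1r, sub0r, addr0, oppr0). Qed.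

Lemma complexificationE g : g = toC (re_part g) + toC (im_part g) * iC.
Proof.
by case: g => a b; congr Cplx;
   rewrite /= ?(mulr0, mulr1, mul0r, subr0, addr0, add0r).
Qed.

End ComplexificationAlgebra.
Arguments iC {R} A.

Definition semisimple (R : realType) (A : falgType R) : Prop :=
  forall I : {vspace A}, ({:A} * I <= I)%VS ->
  exists J : {vspace A},
    [/\ ({:A} * J <= J)%VS, (I + J)%VS = fullv & (I :&: J)%VS = 0%VS].

Section Involution.
Context {R : realType} {A : falgType R}.
Variable sigma : {linear A -> A}.

Definition anti_involution : Prop :=
  (forall a b, sigma (a * b) = sigma b * sigma a) /\
  (forall a, sigma (sigma a) = a).

Definition symA : set A := [set a | sigma a = a].

Definition symA_pos : set A :=
  [set a ^+ 2 | a in symA `&` [set a | a \is a GRing.unit]].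

Definition symA_nneg : set A := [set a ^+ 2 | a in symA].

Definition orthA : set A :=
  [set a | a \is a GRing.unit /\ sigma a = a^-1].

Definition hermitian_pair : Prop :=
  forall x y, symA x -> symA y -> x ^+ 2 + y ^+ 2 = 0 -> x = 0 /\ y = 0.

(* Proper: containing no affine line. *)
Definition proper_convex_cone (C : set A) : Prop :=
  [/\ convex_set (C : set (convex_lmodType A)),
      (forall (t : R) x, 0 < t -> C x -> C (t *: x)) &
      (forall x v, (forall t : R, C (x + t *: v)) -> v = 0)].

(* The standing properties of Hermitian algebras.  They do not all follow from
   [hermitian_pair]: R x R with the exchange involution and M_2(R) with the
   symplectic involution satisfy the latter, but violate the last two fields
   and [standing_orthA_compact].  Compactness is taken in coordinates, for the
   usual topology of R^n. *)
Record hermitian_standing : Prop := {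
  standing_pos_cone : proper_convex_cone symA_pos;
  standing_nneg_cone : proper_convex_cone symA_nneg;
  standing_orthA_compact : compact (passmx.rVof (vbasis {:A}) @` orthA);
  standing_pos_congr : forall a x, a \is a GRing.unit ->
    symA_pos x -> symA_pos (a * x * sigma a);
  standing_nneg_congr : forall a x, a \is a GRing.unit ->
    symA_nneg x -> symA_nneg (a * x * sigma a)
}.

Definition sigmaC (g : complexification A) : complexification A :=
  Cplx (sigma (re_part g)) (sigma (im_part g)).

Lemma sigmaC_toC a : sigmaC (toC a) = toC (sigma a).
Proof. by congr Cplx; rewrite /= linear0. Qed.

Lemma sigmaC_iC g : sigmaC (g * iC A) = sigmaC g * iC A.
Proof.
by congr Cplx; rewrite /= !(mulr0, mulr1, addr0, sub0r) ?linearN.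
Qed.

Definition orthAC : set (complexification A) :=
  [set g | g \is a GRing.unit /\ sigmaC g = g^-1].

End Involution.

Section Plane.
Context {R : realType} {A : falgType R}.
Implicit Types (x y v : 'cV[A]_2) (a b c d : A) (J f : 'cV[A]_2 -> 'cV[A]_2).

(* The right module structure of A^2; [*:] would act on the left. *)
Definition rscale x a : 'cV[A]_2 := x *m a%:M.

Definition right_linear f : Prop :=
  (forall x y, f (x + y) = f x + f y) /\
  (forall x a, f (rscale x a) = rscale (f x) a).

Definition regular_col x : Prop :=
  exists y, right_linear (fun v => rscale x (v 0 0) + rscale y (v 1 0)) /\
            bijective (fun v => rscale x (v 0 0) + rscale y (v 1 0)).

Definition A_line (l : set 'cV[A]_2) : Prop :=
  exists2 x, regular_col x & l = range (rscale x).

Definition mx2 a b c d : 'M[A]_2 :=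
  (block_mx a%:M b%:M c%:M d%:M : 'M[A]_(1 + 1)).

Definition indefinite_involutive J : Prop :=
  [/\ right_linear J, (forall x, J (J x) = x) &
      exists lp lm, [/\ A_line lp, A_line lm,
        (forall x, lp x -> J x = x) & (forall x, lm x -> J x = - x)]].

Definition J0 : 'cV[A]_2 -> 'cV[A]_2 := mulmx (mx2 0 1 1 0).

Definition hat (g : complexification A) : 'M[A]_2 :=
  mx2 (re_part g) (im_part g) (- im_part g) (re_part g).

(* [invmx] needs a commutative base ring. *)
Definition inv2 (M : 'M[A]_2) : 'M[A]_2 :=
  xget 0 [set N | M *m N = 1%:M /\ N *m M = 1%:M].

Definition conjugate (M : 'M[A]_2) J : 'cV[A]_2 -> 'cV[A]_2 :=
  fun x => M *m J (inv2 M *m x).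

Definition is_matrix_group (G : set 'M[A]_2) : Prop :=
  [/\ G 1%:M, (forall M N, G M -> G N -> G (M *m N)) &
      (forall M, G M -> [/\ M *m inv2 M = 1%:M, inv2 M *m M = 1%:M
                          & G (inv2 M)])].

Definition acts_by_conjugation (G : set 'M[A]_2)
    (X : set ('cV[A]_2 -> 'cV[A]_2)) : Prop :=
  [/\ (forall M J, G M -> X J -> X (conjugate M J)),
      (forall J, X J -> conjugate 1%:M J = J) &
      (forall M N J, G M -> G N -> X J ->
         conjugate (M *m N) J = conjugate M (conjugate N J))].

Section Forms.
Variable sigma : {linear A -> A}.

Definition sesqui_form (S : 'M[A]_2) x y : A :=
  ((map_mx sigma x)^T *m S *m y) 0 0.

Definition form_h := sesqui_form (mx2 0 1 1 0).
Definition form_b := sesqui_form (mx2 (-1) 0 0 1).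

Definition sigma_inner_product (beta : 'cV[A]_2 -> 'cV[A]_2 -> A) : Prop :=
  [/\ (forall x x' y, beta (x + x') y = beta x y + beta x' y),
      (forall x y y', beta x (y + y') = beta x y + beta x y'),
      (forall x y r1 r2,
         beta (rscale x r1) (rscale y r2) = sigma r1 * beta x y * r2),
      (forall x y, beta x y = sigma (beta y x)) &
      (forall x, regular_col x ->
         symA_nneg sigma (beta x x) /\ (beta x x = 0 <-> x = 0))].

Definition C_Aut_h : set ('cV[A]_2 -> 'cV[A]_2) :=
  [set J | indefinite_involutive J /\
           sigma_inner_product (fun x y => form_h (J x) y)].

Definition C_G : set ('cV[A]_2 -> 'cV[A]_2) :=
  [set J | forall x y, form_b (J x) (J y) = - form_b x y] `&` C_Aut_h.

Definition hatG : set 'M[A]_2 := [set hat g | g in orthAC sigma].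
Definition hatK : set 'M[A]_2 := [set hat (toC a) | a in orthA sigma].

End Forms.
End Plane.

(* Main.v *)
Require Import Defs.
From mathcomp Require Import all_boot all_order all_algebra all_field.
From mathcomp Require Import all_classical all_reals all_analysis.
From mathcomp Require Import complex ring lra.
Set Implicit Arguments.
Unset Strict Implicit.
Unset Printing Implicit Defensive.
Import Order.TTheory GRing.Theory Num.Theory.
Local Open Scope classical_set_scope.
Local Open Scope ring_scope.

(* An element J of C_G is x |-> H S x with H = [[0,1],[1,0]]; the conditions on
   J force S = hat s with s = p + q i, sigma(q) = -q, p q = q p, p^2 + q^2 = 1,
   p in the nonnegative cone, so that s (conj s) = 1.  If y is a symmetric square
   root of 2 + 2p = (1 + s)(1 + conj s), then g = (1 + conj s) y^-1 lies in G, and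
   conj g = s g says exactly that hat g conjugates J0 to J.  Conversely J0 lies in
   C_G because sigma(a) a is always a square of a symmetric element: for units
   this is the invariance of the cone; in general,
     sigma(a + t)(a + t) + sigma(a - t)(a - t) = 2 (sigma(a) a + t^2)
   with a + t, a - t invertible for arbitrarily small t, and the set of squares is
   closed, since a limit of squares is annihilated by a real polynomial with
   distinct nonnegative roots, on which sqrt can be interpolated.  Definiteness:
   if sigma(a) a = 0, properness of the cone gives sigma(a) = -a, so a^2 = 0;
   the same holds for every a b, and semisimplicity gives a = 0. *)

(** * Real polynomials: factors of low degree and interpolation *)

(** A root [u + iv] over the algebraically closed [R[i]] is real if [v = 0] and gives a linear
    factor; otherwise it is also a root of [(X - u)^2 + v^2], which then divides [P]. *)
Lemma poly_factor_rcf (R : rcfType) (P : {poly R}) : (1 < size P)%N ->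
  (exists x (Q : {poly R}), (size Q < size P)%N /\ P = Q * ('X - x%:P)) \/
  (exists u v (Q : {poly R}), [/\ v != 0, (size Q < size P)%N &
     P = Q * (('X - u%:P) ^+ 2 + (v ^+ 2)%:P)]).
Proof.
move=> sP.
have /closed_rootP[[u v] rz] : size (map_poly (real_complex R) P) != 1%N.
  by rewrite size_map_poly neq_ltn sP orbT.
have [v0|v0] := eqVneq v 0.
  have /factor_theorem[Q PQ] : root P u; last first.
    left; exists u, Q; split=> //; have Q0 : Q != 0.
      by apply: contraTneq sP => Q0; rewrite PQ Q0 mul0r size_poly0.
    by rewrite PQ size_Mmonic ?monicXsubC // size_XsubC addn2.
  by move: rz; rewrite v0 -[(u +i* 0)%C]/(real_complex R u) fmorph_root.
right; exists u, v.
set D := _ + _.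
have D_monic : D \is monic.
  rewrite monicE lead_coefDl ?lead_coef_exp ?lead_coefXsubC ?expr1n //.
  by rewrite size_exp_XsubC (leq_ltn_trans (size_polyC_leq1 _)).
have sD : size D = 3%N.
  rewrite size_polyDl ?size_exp_XsubC //.
  by rewrite (leq_ltn_trans (size_polyC_leq1 _)).
have D0 : D != 0 by rewrite -size_poly_gt0 sD.
exists (P %/ D); split => //.
  rewrite size_divp // sD; case: (size P) sP => // m _.
  by rewrite subSS ltnS leq_subr.
rewrite [LHS](divp_eq P D); set r := P %% D.
suff -> : r = 0 by rewrite addr0.
have sr : (size r <= 2)%N by rewrite -ltnS -sD ltn_modp.
have rD : root (map_poly (real_complex R) D) (u +i* v)%C.
  rewrite /root /D rmorphD rmorphXn /= rmorphB /= map_polyX !map_polyC /=.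
  rewrite !hornerE; apply/eqP; rewrite expr2; simpc.
  by rewrite -expr2 addNr.
move: rz; rewrite (divp_eq P D) -/r rmorphD rmorphM /= /root hornerD hornerM.
rewrite (eqP rD) mulr0 add0r.
(* The remainder is [r_1 X + r_0]. Its value at [u + iv] has imaginary part [r_1 v], so [r_1 = 0],
   and then [r_0 = 0]. *)
have -> : r = (r`_1)%:P * 'X + (r`_0)%:P.
  apply/polyP => -[|[|i]]; rewrite !coefE /= ?addr0 ?add0r ?mulr1 ?mulr0 //.
    by rewrite add0r.
  by rewrite nth_default // (leq_trans sr).
rewrite rmorphD rmorphM /= map_polyX !map_polyC /= !hornerE.
case/eqP; simpc => h1 /eqP; rewrite mulf_eq0 (negPf v0) orbF => /eqP r1.
by move: h1; rewrite r1 mul0r add0r => ->; rewrite !polyC0 mul0r addr0.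
Qed.

Lemma lagrange_interpolation (R : fieldType) (l : seq R) (f : R -> R) :
  uniq l -> exists P : {poly R}, {in l, forall x, P.[x] = f x}.
Proof.
elim: l => [|a l IH] /=; first by exists 0.
case/andP=> al /IH[P hP].
pose W := \prod_(x <- l) ('X - x%:P).
have Wa : W.[a] != 0 by rewrite -/(root W a) root_prod_XsubC.
(* [W] vanishes on [l], so this multiple of it corrects the value at [a] only. *)
exists (P + ((f a - P.[a]) / W.[a])%:P * W) => x; rewrite inE !hornerE.
case/orP=> [/eqP->|xl]; first by rewrite divfK // addrC subrK.
have /eqP-> : root W x by rewrite root_prod_XsubC.
by rewrite mulr0 addr0 hP.
Qed.

(** * Annihilating polynomials in a finite-dimensional algebra *)

Section FiniteDimensional.
Variables (K : fieldType) (A : falgType K).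
Implicit Types a b : A.


(** The powers of [a] with exponents from 0 to the dimension are one too many to be free. *)
Lemma annihilating_poly a : exists2 P : {poly K}, P != 0 & horner_alg a P = 0.
Proof.
pose n := (\dim {:A}).+1.
pose X := [tuple a ^+ i | i < n].
have : ~~ free X.
  apply/negP => /eqP fX.
  by have := dimvS (subvf <<X>>%VS); rewrite fX size_tuple ltnn.
move/freeP; rewrite -existsNE => -[k /not_implyP[k0 /existsNP[i ki]]].
exists (\poly_(j < n) (if insub j is Some j' then k j' else 0)).
  apply/eqP => /polyP/(_ i); rewrite coef_poly ltn_ord coef0 insubT //= => ?.
  by move=> kk; apply: ki; rewrite -[RHS]kk; congr k; apply: val_inj.
rewrite poly_def linear_sum /= -[RHS]k0; apply: eq_bigr => j _.
rewrite valK linearZ /= rmorphXn /= horner_algX.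
by rewrite (nth_map j) ?size_enum_ord // nth_ord_enum -scalerAl mul1r.
Qed.

(** Writing [P - P(t) = Q (X - t)] and evaluating at [a] gives [Q(a) (a - t) = - P(t)], a nonzero
    scalar. *)
Lemma unit_of_annihilating_poly a (P : {poly K}) (t : K) :
  horner_alg a P = 0 -> ~~ root P t -> a - t%:A \is a GRing.unit.
Proof.
move=> Pa Pt.
have /factor_theorem[Q PQ] : root (P - P.[t]%:P) t.
  by rewrite /root !hornerE subrr.
have aE : horner_alg a ('X - t%:P) = a - t%:A.
  by rewrite rmorphB /= horner_algX horner_algC.
have QE : horner_alg a Q * (a - t%:A) = - P.[t]%:A.
  by rewrite -aE -rmorphM -PQ rmorphB /= Pa horner_algC sub0r.
have QE' : (a - t%:A) * horner_alg a Q = - P.[t]%:A.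
  by rewrite -aE -rmorphM mulrC -PQ rmorphB /= Pa horner_algC sub0r.
apply/unitrP; exists (- P.[t]^-1 *: horner_alg a Q).
by rewrite -scalerAl -scalerAr QE QE' scaleNr scalerN opprK scalerA mulVf ?scale1r.
Qed.

Lemma horner_alg_comm a b P : a * b = b * a ->
  a * horner_alg b P = horner_alg b P * a.
Proof.
move=> ab; elim/poly_ind: P => [|Q c IH]; first by rewrite rmorph0 mulr0 mul0r.
rewrite rmorphD rmorphM /= horner_algX horner_algC mulrDr mulrDl mulrA IH.
by rewrite -!mulrA ab -scalerAl -scalerAr mulr1 mul1r.
Qed.

End FiniteDimensional.

(** * Spectra of symmetric elements and closedness of the set of squares *)

Section HermitianAlgebra.
Variables (R : realType) (A : falgType R) (sigma : {linear A -> A}).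
Hypothesis hsigma : anti_involution sigma.
Implicit Types (a b s z : A) (P Q : {poly R}).

Lemma anti_invM a b : sigma (a * b) = sigma b * sigma a.
Proof. exact: hsigma.1. Qed.

Lemma anti_invK : involutive sigma.
Proof. exact: hsigma.2. Qed.

Lemma anti_inv1 : sigma 1 = 1.
Proof. by rewrite -[LHS]mul1r -{1}(anti_invK 1) -anti_invM mul1r anti_invK. Qed.

Lemma anti_inv_unit a : a \is a GRing.unit -> sigma a \is a GRing.unit.
Proof.
move=> ua; apply/unitrP; exists (sigma a^-1).
by rewrite -!anti_invM mulrV // mulVr // anti_inv1.
Qed.

Lemma horner_alg_sym s P : symA sigma s -> symA sigma (horner_alg s P).
Proof.
rewrite /symA /= => hs; elim/poly_ind: P => [|P c IH]; first by rewrite !linear0.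
rewrite rmorphD rmorphM /= horner_algX horner_algC linearD linearZ /= anti_inv1.
by rewrite anti_invM IH hs (horner_alg_comm _ (erefl (s * s))).
Qed.

Hypothesis hherm : hermitian_pair sigma.

Lemma herm_sqr_eq0 s : symA sigma s -> s ^+ 2 = 0 -> s = 0.
Proof.
move=> hs s0; apply: (hherm hs hs _).1; by rewrite s0 addr0.
Qed.

(** The square of [(Q P)(s)] is [(Q^2 P)(s) P(s) = 0], and a symmetric element of square zero
    vanishes. This removes repeated factors. *)
Lemma horner_alg_sqr_eq0 s P Q : symA sigma s ->
  horner_alg s (Q ^+ 2 * P) = 0 -> horner_alg s (Q * P) = 0.
Proof.
move=> hs h; apply: herm_sqr_eq0; first exact: horner_alg_sym.
by rewrite -rmorphXn /= exprMn expr2 (expr2 P) mulrA rmorphM -expr2 /= h mul0r.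
Qed.

(** The symmetric elements [((X - u) P)(s)] and [v P(s)] have squares summing to zero, so both
    vanish. This removes nonreal roots. *)
Lemma horner_alg_sum_sqr_eq0 s P u (v : R) : symA sigma s -> v != 0 ->
  horner_alg s (P * (('X - u%:P) ^+ 2 + (v ^+ 2)%:P)) = 0 -> horner_alg s P = 0.
Proof.
move=> hs v0 h.
have [] := hherm (horner_alg_sym (('X - u%:P) * P) hs)
                (horner_alg_sym (v%:P * P) hs).
  rewrite -!rmorphXn -rmorphD /= !exprMn -mulrDl expr2 mulrA rmorphM /=.
  by rewrite -[(v%:P) ^+ 2]rmorphXn /= (mulrC _ P) h mul0r.
move=> _; rewrite rmorphM /= horner_algC -scalerAl mul1r => /eqP.
by rewrite scaler_eq0 (negPf v0) => /eqP.
Qed.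

(** Approximation of [s] by squares along the single direction 1, which avoids a topology on [A]. *)
Definition nneg_limit s := forall e : R, 0 < e ->
  exists t, [/\ 0 < t, t < e & symA_nneg sigma (s + t%:A)].

(** With [z = P(s)] one has [z s = x z]. Take [s + t = y^2] with [t < - x]; then [y] commutes with
    [s], hence with [z], and [(y z)^2 = (x + t) z^2 = - (w z)^2] for [w^2 = - x - t > 0]. The
    Hermitian condition forces [w z = 0]. *)
Lemma horner_alg_neg_root s P (x : R) : symA sigma s -> nneg_limit s -> x < 0 ->
  horner_alg s (P * ('X - x%:P)) = 0 -> horner_alg s P = 0.
Proof.
move=> hs hlim x0; set z := horner_alg s P.
rewrite rmorphM rmorphB /= horner_algX horner_algC -/z.
rewrite mulrBr -scalerAr mulr1 => /subr0_eq zs.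
have hz : sigma z = z := horner_alg_sym P hs.
have [t [t0 tx [y hy yE]]] : exists t,
    [/\ 0 < t, t < - x & symA_nneg sigma (s + t%:A)].
  by apply: hlim; rewrite oppr_gt0.
have ys : y * s = s * y.
  have -> : s = y ^+ 2 - t%:A by rewrite yE addrK.
  by rewrite mulrBr mulrBl -exprS -exprSr -scalerAl -scalerAr mulr1 mul1r.
have yz : y * z = z * y by exact: horner_alg_comm.
pose w := Num.sqrt (- x - t).
have ww : w ^+ 2 = - x - t by rewrite sqr_sqrtr // subr_ge0 ltW.
have w0 : w != 0 by rewrite sqrtr_eq0 -ltNge subr_gt0.
have [] := hherm (x := y * z) (y := w *: z).
- by rewrite /symA /= anti_invM hz hy yz.
- by rewrite /symA /= linearZ /= hz.
- rewrite exprZn ww yz exprMn_comm; last by rewrite /GRing.comm yz.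
  rewrite yE mulrDr expr2 -mulrA zs -!scalerAr mulr1 -!scalerDl.
  by rewrite -opprD subrr scale0r.
by move=> _ /eqP; rewrite scaler_eq0 (negPf w0) => /eqP.
Qed.

Lemma nneg_spectrum s : symA sigma s -> nneg_limit s ->
  exists l : seq R, [/\ uniq l, {in l, forall x, 0 <= x} &
    horner_alg s (\prod_(x <- l) ('X - x%:P)) = 0].
Proof.
move=> hs hlim.
(* Induction on the degree of the factor [P] still to be split, while [l] collects the distinct
   nonnegative roots found so far. *)
suff H n : forall P l, (size P <= n)%N -> P != 0 -> uniq l ->
    {in l, forall x, 0 <= x} ->
    horner_alg s (P * \prod_(x <- l) ('X - x%:P)) = 0 ->
    exists l : seq R, [/\ uniq l, {in l, forall x, 0 <= x} &
      horner_alg s (\prod_(x <- l) ('X - x%:P)) = 0].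
  have [P P0 sP] := annihilating_poly s.
  by apply: (H (size P) P [::]) => //; rewrite big_nil mulr1.
elim: n => [|n IH] P l sP P0 ul l0.
  by rewrite leqn0 size_poly_eq0 (negPf P0) in sP.
have [/poly_factor_rcf PE|sP1] := ltnP 1 (size P); last first.
  move=> h; exists l; split => //.
  have [c PE] : exists c, P = c%:P by exists P`_0; apply: size1_polyC.
  move: h P0; rewrite PE polyC_eq0 rmorphM /= horner_algC -scalerAl mul1r => /eqP.
  by rewrite scaler_eq0 => /orP[->//|/eqP].
case: PE => [[x [Q [sQ PQ]]]|[u [v [Q [v0 sQ PQ]]]]];
  have Q0 : Q != 0 by apply: contraNneq P0 => Q0; rewrite PQ Q0 mul0r.
  have {}IH := IH Q _ (leq_trans sQ sP) Q0.
  rewrite PQ mulrAC -mulrA.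
  have [x0|x0] := ltP x 0.
    rewrite mulrA => /(horner_alg_neg_root hs hlim x0); exact: IH.
  (* A root already in [l] occurs squared and is reduced to multiplicity one; a new one joins
     [l]. *)
  have [/rot_to[i l' lE]|xl] := boolP (x \in l).
    have pE : \prod_(y <- l) ('X - y%:P) =
        ('X - x%:P) * \prod_(y <- l') ('X - y%:P).
      by rewrite -(perm_big _ (permEl (perm_rot i l))) lE big_cons.
    rewrite pE => h; apply: (IH l) => //; rewrite pE mulrCA.
    by apply: horner_alg_sqr_eq0; rewrite // -[RHS]h; congr horner_alg; ring.
  move=> h; apply: (IH (x :: l)); rewrite ?big_cons /= ?xl ?ul //; last first.
    by rewrite -[RHS]h; congr horner_alg; ring.
  by move=> y; rewrite inE => /predU1P[->//|]; exact: l0.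
rewrite PQ mulrAC => /(horner_alg_sum_sqr_eq0 hs v0).
by apply: (IH Q) => //; exact: (leq_trans sQ sP).
Qed.

Lemma nneg_closed s : symA sigma s -> nneg_limit s -> symA_nneg sigma s.
Proof.
move=> hs hlim; have [l [ul l0 hl]] := nneg_spectrum hs hlim.
have [P hP] := lagrange_interpolation Num.sqrt ul.
exists (horner_alg s P); first exact: horner_alg_sym.
(* [P] takes the value [sqrt x] at each [x] in [l], so [P^2 - X] vanishes on [l] and is killed by
   evaluation at [s]. *)
have /dvdpP[Q PQ] : \prod_(x <- l) ('X - x%:P) %| P ^+ 2 - 'X.
  apply: uniq_roots_dvdp; last by rewrite uniq_rootsE.
  apply/allP => x xl; rewrite /root !hornerE hP // sqr_sqrtr ?subrr //; exact: l0.
apply/subr0_eq; rewrite -rmorphXn -[X in _ - X](horner_algX s) -rmorphB PQ.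
by rewrite rmorphM /= hl mulr0.
Qed.

End HermitianAlgebra.

(** * Positivity and definiteness of [sigma a * a] *)

Lemma small_nonroot (R : realFieldType) (P : {poly R}) (e : R) :
  P != 0 -> 0 < e -> exists t, [/\ 0 < t, t < e & ~~ root P t].
Proof.
move=> P0 e0; apply: contrapT => H.
(* The points [e/2, e/3, ...] lie strictly below [e]; [size P] of them exceed the possible number of
   roots. *)
pose f k : R := e / k.+2%:R.
have : ~~ (size [seq f k | k <- iota 0 (size P)] < size P)%N.
  by rewrite size_map size_iota ltnn.
case/negP; apply: max_poly_roots => //.
  apply/allP => _ /mapP[k _ ->]; apply: contra_notT H => rk; exists (f k).
  by rewrite divr_gt0 ?ltr_pdivrMr // ltr_pMr // ltr1n.
rewrite map_inj_uniq ?iota_uniq // => i j /(mulfI (lt0r_neq0 e0))/invr_inj/eqP.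
by rewrite eqr_nat => /eqP[].
Qed.

(** A noncommutative parallelogram law, to be used with [y] and [w] equal to a scalar [t]. *)
Lemma mulr_sum_diff (S : pzRingType) (x y z w : S) :
  (x + y) * (z + w) + (x - y) * (z - w) = (x * z + y * w) *+ 2.
Proof.
rewrite !mulrDl !mulrDr mulrNN mulrN mulNr addrACA (addrACA (x * z)) subrr addr0.
by rewrite (addrACA (y * z)) subrr add0r mulr2n addrACA.
Qed.

Section Positivity.
Variables (R : realType) (A : falgType R) (sigma : {linear A -> A}).
Hypothesis hsigma : anti_involution sigma.
Implicit Types (a b s z : A) (P Q : {poly R}).

Lemma small_unit_shift a (e : R) : 0 < e ->
  exists t, [/\ 0 < t, t < e, a + t%:A \is a GRing.unit
    & a - t%:A \is a GRing.unit].
Proof.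
move=> e0; have [P P0 Pa] := annihilating_poly a.
have [Q Q0 Qa] := annihilating_poly (- a).
have [t [t0 te]] := small_nonroot (mulf_neq0 P0 Q0) e0.
rewrite rootM negb_or => /andP[Pt Qt]; exists t; split => //.
  by rewrite -unitrN opprD (unit_of_annihilating_poly Qa Qt).
exact: unit_of_annihilating_poly Pa Pt.
Qed.

Hypothesis hherm : hermitian_pair sigma.
Hypothesis hstd : hermitian_standing sigma.

Lemma nneg_scale (t : R) a : 0 <= t ->
  symA_nneg sigma a -> symA_nneg sigma (t *: a).
Proof.
move=> t0 [b hb <-]; exists (Num.sqrt t *: b); last by rewrite exprZn sqr_sqrtr.
by rewrite /symA /= linearZ /= hb.
Qed.

Lemma nneg1 : symA_nneg sigma 1.
Proof. by exists 1; rewrite ?expr1n //; exact: anti_inv1. Qed.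

Lemma nneg_add a b :
  symA_nneg sigma a -> symA_nneg sigma b -> symA_nneg sigma (a + b).
Proof.
move=> ha hb; have [cvx scal _] := standing_nneg_cone hstd.
have k0 : 0 <= 2^-1 :> R by lra.
have k1 : 2^-1 <= 1 :> R by lra.
have := cvx a b (Itv01 k0 k1); rewrite !inE => /(_ ha hb).
move/(@nneg_scale 2 _ (ler0n _ 2)); congr symA_nneg.
rewrite -[X in 2 *: X]/(2^-1 *: a + (1 - 2^-1) *: b).
have -> : 1 - 2^-1 = 2^-1 :> R by lra.
by rewrite scalerDr !scalerA divff // !scale1r.
Qed.

Lemma nneg_sym_mul a : symA_nneg sigma (sigma a * a).
Proof.
apply: (nneg_closed hsigma hherm).
  by rewrite /symA /= (anti_invM hsigma) anti_invK.
move=> e e0.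
(* The bound 1 ensures [t^2 <= t < e]. *)
have [|t [t0 te up um]] := @small_unit_shift a (Num.min 1 e).
  by rewrite lt_min ltr01.
move: te; rewrite lt_min => /andP[t1 te].
exists (t ^+ 2); rewrite exprn_gt0 //; split => //.
  by rewrite (le_lt_trans _ te) // expr2 ger_pMl ?ltW.
(* For a unit [c], this is the image of 1 under the congruence by [sigma c]. *)
have Hu c : c \is a GRing.unit -> symA_nneg sigma (sigma c * c).
  move=> uc; have := standing_nneg_congr hstd (anti_inv_unit hsigma uc) nneg1.
  by rewrite mulr1 anti_invK.
have := nneg_add (Hu _ up) (Hu _ um).
have k0 : 0 <= 2^-1 :> R by lra.
move/(nneg_scale k0); congr symA_nneg.
rewrite (linearD sigma) (linearB sigma) !(linearZ_LR sigma) /=.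
rewrite (anti_inv1 hsigma) mulr_sum_diff -[X in _ *: X]scaler_nat.
by rewrite !scalerA mulVf ?pnatr_eq0 // !scale1r -scalerAl mul1r scalerA expr2.
Qed.

Lemma nneg_eq0 a b :
  symA_nneg sigma a -> symA_nneg sigma b -> a + b = 0 -> a = 0 /\ b = 0.
Proof.
by move=> [x hx <-] [y hy <-] /(hherm hx hy)[-> ->]; rewrite expr0n.
Qed.

(** For [t != 0], the cone contains [t^2 sigma(a + 1/t) (a + 1/t) = 1 + t (sigma a + a)]. Thus it
    contains a whole line through 1, unless the direction [sigma a + a] is zero. *)
Lemma sym_mul_eq0_skew a : sigma a * a = 0 -> sigma a = - a.
Proof.
move=> aa; apply/eqP; rewrite -addr_eq0; apply/eqP.
have [_ _ prop] := standing_nneg_cone hstd.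
apply: (prop 1) => t; have [->|t0] := eqVneq t 0.
  by rewrite scale0r addr0; exact: nneg1.
have := nneg_sym_mul (a + t^-1%:A).
move/(nneg_scale (sqr_ge0 t)); congr symA_nneg.
rewrite (linearD sigma) (linearZ_LR sigma) /= (anti_inv1 hsigma).
rewrite mulrDl !mulrDr aa add0r.
rewrite -!scalerAl -!scalerAr mulr1 !mul1r !scalerDr !scalerA.
rewrite expr2 mulfK // divff // scale1r.
by rewrite addrA addrC.
Qed.

Lemma sym_mul_eq0 a : semisimple A -> sigma a * a = 0 -> a = 0.
Proof.
move=> ss aa.
have nil b : (a * b) ^+ 2 = 0.
  have abab : sigma (a * b) * (a * b) = 0.
    by rewrite (anti_invM hsigma) mulrA -(mulrA (sigma b)) aa mulr0 mul0r.
  move: (abab); rewrite (sym_mul_eq0_skew abab) mulNr -expr2 => /eqP.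
  by rewrite oppr_eq0 => /eqP.
(* The left ideal [A a] has a complementary left ideal [J]; decompose [1 = e + f] accordingly. *)
pose I := (amulr a @: {:A})%VS.
have memI b : b * a \in I by have := memv_img (amulr a) (memvf b); rewrite lfunE.
have [|J [JJ IJ IJ0]] := ss I.
  by apply/prodvP => u _ _ /memv_imgP[b _ ->]; rewrite lfunE /= mulrA.
have : 1 \in (I + J)%VS by rewrite IJ memvf.
case/memv_addP => e eI [f fJ ef].
have IJ_eq0 x : x \in I -> x \in J -> x = 0.
  by move=> xI xJ; apply/eqP; rewrite -memv0 -IJ0 memv_cap xI.
have JA u x : x \in J -> u * x \in J.
  by move=> xJ; apply: (subvP JJ); rewrite memv_mul ?memvf.
have [b _ eb] := memv_imgP eI; rewrite lfunE /= in eb.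
(* The difference [e - e^2 = e f] lies in both ideals. So [e = b a] is idempotent, and
   [e = e^3 = b (a b)^2 a = 0]; then [1 = f] lies in [J], hence so does [a]. *)
have ee : e = e * e.
  apply/subr0_eq/IJ_eq0; last first.
    by rewrite -[X in X - _]mulr1 -mulrBr ef addrC addKr JA.
  by rewrite rpredB // {2}eb mulrA.
have e0 : e = 0.
  have -> : e = b * (a * b) ^+ 2 * a by rewrite {1}ee {1}ee eb expr2 !mulrA.
  by rewrite nil mulr0 mul0r.
apply: IJ_eq0; first by rewrite -[a]mul1r.
by rewrite -[a]mulr1 ef e0 add0r JA.
Qed.

End Positivity.

(** * Two-by-two matrices, columns and lines over [A] *)

Section Mx2.
Variables (R : realType) (A : falgType R).
Implicit Types (a b c d : A) (x y : 'cV[A]_2) (J : 'cV[A]_2 -> 'cV[A]_2).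
Implicit Types (g k : complexification A) (M N : 'M[A]_2).

Lemma mx2E a b c d i j : mx2 a b c d i j =
  if i == 0 then (if j == 0 then a else b) else (if j == 0 then c else d).
Proof.
rewrite /mx2 !mxE; case: splitP => k; rewrite (ord1 k) !mxE => ik;
  case: splitP => l; rewrite (ord1 l) !mxE => jl;
  by rewrite -!val_eqE /= ik jl /= ?mulr1n.
Qed.

Lemma ord2P (P : 'I_2 -> Prop) : P 0 -> P 1 -> forall i, P i.
Proof.
move=> P0 P1 [[|[|//]] i2].
- by rewrite (_ : Ordinal i2 = 0) //; apply: val_inj.
- by rewrite (_ : Ordinal i2 = 1) //; apply: val_inj.
Qed.

Lemma mx2_eqP M N :
  M 0 0 = N 0 0 -> M 0 1 = N 0 1 -> M 1 0 = N 1 0 -> M 1 1 = N 1 1 -> M = N.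
Proof.
by move=> h00 h01 h10 h11; apply/matrixP => i j; elim/ord2P: i; elim/ord2P: j.
Qed.

Lemma col2_eqP x y : x 0 0 = y 0 0 -> x 1 0 = y 1 0 -> x = y.
Proof. by move=> h0 h1; apply/colP => i; elim/ord2P: i. Qed.

Lemma mulmx2E m n (M : 'M[A]_(m, 2)) (N : 'M[A]_(2, n)) i j :
  (M *m N) i j = M i 0 * N 0 j + M i 1 * N 1 j.
Proof.
rewrite mxE big_ord_recl big_ord1.
by congr (_ + M i _ * N _ j); apply: val_inj.
Qed.

Lemma mx2M a b c d a' b' c' d' : mx2 a b c d *m mx2 a' b' c' d' =
  mx2 (a * a' + b * c') (a * b' + b * d') (c * a' + d * c') (c * b' + d * d').
Proof. by apply: mx2_eqP; rewrite mulmx2E !mx2E. Qed.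

Lemma mx2_1 : mx2 1 0 0 1 = 1%:M :> 'M[A]_2.
Proof. by apply: mx2_eqP; rewrite mx2E mxE. Qed.

Lemma hatM g k : hat (g * k) = hat g *m hat k.
Proof.
by rewrite mx2M; congr mx2; rewrite /= ?mulrN ?mulNr ?opprD // addrC.
Qed.

Lemma hat1 : hat 1 = 1%:M :> 'M[A]_2.
Proof. by rewrite -mx2_1 /hat /= oppr0. Qed.

Lemma inv2_eq M N : M *m N = 1%:M -> N *m M = 1%:M -> inv2 M = N.
Proof.
move=> MN NM; have [_ h] : [set N | M *m N = 1%:M /\ N *m M = 1%:M] (inv2 M).
  exact: xgetI (conj MN NM).
by rewrite -[LHS]mulmx1 -MN mulmxA h mul1mx.
Qed.

Lemma conjugate1 J : conjugate 1%:M J = J.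
Proof.
by apply/funext => x; rewrite /conjugate (inv2_eq (mul1mx _) (mul1mx _)) !mul1mx.
Qed.

Definition col2 a b : 'cV[A]_2 := \col_i (if i == 0 then a else b).

Lemma rscaleE x a i : rscale x a i 0 = x i 0 * a.
Proof. by rewrite mxE big_ord1 mxE eqxx mulr1n. Qed.

Lemma col2_basis x : x = rscale (col2 1 0) (x 0 0) + rscale (col2 0 1) (x 1 0).
Proof.
by apply: col2_eqP; rewrite mxE !rscaleE !mxE !(mul1r, mul0r) ?addr0 ?add0r.
Qed.

Lemma right_linear_mulmx M : right_linear (mulmx M).
Proof. by split=> *; rewrite ?mulmxDr // /rscale mulmxA. Qed.

Lemma right_linear_mx2 J : right_linear J ->
  J =1 mulmx (mx2 (J (col2 1 0) 0 0) (J (col2 0 1) 0 0)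
                  (J (col2 1 0) 1 0) (J (col2 0 1) 1 0)).
Proof.
move=> [JD JZ] x; rewrite {1}(col2_basis x) JD !JZ.
by apply: col2_eqP; rewrite mulmx2E !mx2E /= mxE !rscaleE.
Qed.

Lemma rscaleD_right_linear x y :
  right_linear (fun v => rscale x (v 0 0) + rscale y (v 1 0)).
Proof.
have E a b i : (rscale x a + rscale y b) i 0 = x i 0 * a + y i 0 * b.
  by rewrite mxE !rscaleE.
split=> [u v|u a]; apply/colP => i.
  by rewrite [RHS]mxE !E ![(u + v) _ _]mxE !mulrDr addrACA.
by rewrite [RHS]rscaleE !E !rscaleE mulrDl !mulrA.
Qed.

Lemma regular_col_mulmx M N x :
  M *m N = 1%:M -> N *m M = 1%:M -> regular_col x -> regular_col (M *m x).
Proof.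
move=> MN NM [y [_ xy]]; exists (M *m y); split; first exact: rscaleD_right_linear.
have Mbij : bijective (mulmx M : 'cV_2 -> 'cV_2).
  exists (mulmx N) => v; first by rewrite mulmxA NM mul1mx.
  by rewrite mulmxA MN mul1mx.
apply: (eq_bij (bij_comp Mbij xy)).
by move=> v /=; rewrite mulmxDr /rscale !mulmxA.
Qed.

(** The other column of the invertible matrix completes the first to a basis. *)
Lemma regular_col2 a b c d (N : 'M[A]_2) : mx2 a b c d *m N = 1%:M ->
  N *m mx2 a b c d = 1%:M -> regular_col (col2 a c).
Proof.
move=> MN NM; exists (col2 b d); split; first exact: rscaleD_right_linear.
have Mbij : bijective (mulmx (mx2 a b c d) : 'cV_2 -> 'cV_2).
  exists (mulmx N) => v; first by rewrite mulmxA NM mul1mx.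
  by rewrite mulmxA MN mul1mx.
apply: (eq_bij Mbij) => v.
by apply: col2_eqP; rewrite mulmx2E !mx2E mxE !rscaleE !mxE.
Qed.

Lemma A_line_mulmx M N (l : set 'cV[A]_2) :
  M *m N = 1%:M -> N *m M = 1%:M -> A_line l -> A_line (mulmx M @` l).
Proof.
move=> MN NM [x xreg ->]; exists (M *m x); first exact: regular_col_mulmx MN NM xreg.
rewrite image_comp; apply: eq_imagel => a _.
by rewrite /= /rscale mulmxA.
Qed.

End Mx2.

(** * The conjugation action of [hatG] and the stabilizer of [J0] *)

Section Action.
Variables (R : realType) (A : falgType R) (sigma : {linear A -> A}).
Hypothesis hsigma : anti_involution sigma.
Implicit Types (a b c d : A) (x y : 'cV[A]_2) (J : 'cV[A]_2 -> 'cV[A]_2).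
Implicit Types (g k : complexification A) (M N : 'M[A]_2).

Lemma sigmaCM g k : sigmaC sigma (g * k) = sigmaC sigma k * sigmaC sigma g.
Proof.
congr Cplx; rewrite /= ?linearB ?linearD /= !(anti_invM hsigma) //.
by rewrite addrC.
Qed.

Lemma sigmaCK : involutive (sigmaC sigma).
Proof. by case=> a b; congr Cplx; rewrite /= (anti_invK hsigma). Qed.

Lemma sigmaC1 : sigmaC sigma 1 = 1.
Proof. by congr Cplx; rewrite /= ?linear0 ?(anti_inv1 hsigma). Qed.

Lemma orthACP g :
  orthAC sigma g <-> sigmaC sigma g * g = 1 /\ g * sigmaC sigma g = 1.
Proof.
split=> [[ug ->]|[h1 h2]]; first by rewrite mulVr // mulrV.
have ug : g \is a GRing.unit by apply/unitrP; exists (sigmaC sigma g).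
by split=> //; rewrite -[LHS](mulrK ug) h1 mul1r.
Qed.

Lemma orthAC1 : orthAC sigma 1.
Proof. by apply/orthACP; rewrite sigmaC1 mul1r. Qed.

Lemma orthACM g k : orthAC sigma g -> orthAC sigma k -> orthAC sigma (g * k).
Proof.
move=> /orthACP[g1 g2] /orthACP[k1 k2]; apply/orthACP; rewrite sigmaCM; split.
  by rewrite mulrA -(mulrA _ _ g) g1 mulr1.
by rewrite mulrA -(mulrA g) k2 mulr1.
Qed.

Lemma orthAC_sigmaC g : orthAC sigma g -> orthAC sigma (sigmaC sigma g).
Proof. by move=> /orthACP[g1 g2]; apply/orthACP; rewrite sigmaCK. Qed.

Lemma hat_sigmaCl g : orthAC sigma g -> hat (sigmaC sigma g) *m hat g = 1%:M.
Proof. by move=> /orthACP[g1 _]; rewrite -hatM g1 hat1. Qed.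

Lemma hat_sigmaCr g : orthAC sigma g -> hat g *m hat (sigmaC sigma g) = 1%:M.
Proof. by move=> /orthACP[_ g2]; rewrite -hatM g2 hat1. Qed.

Lemma inv2_hat g : orthAC sigma g -> inv2 (hat g) = hat (sigmaC sigma g).
Proof. by move=> Gg; rewrite (inv2_eq (hat_sigmaCr Gg) (hat_sigmaCl Gg)). Qed.

Lemma sesqui_formE a b c d x y : sesqui_form sigma (mx2 a b c d) x y =
  (sigma (x 0 0) * a + sigma (x 1 0) * c) * y 0 0 +
  (sigma (x 0 0) * b + sigma (x 1 0) * d) * y 1 0.
Proof. by rewrite /sesqui_form !mulmx2E !mx2E !mxE. Qed.

Lemma form_hE x y :
  form_h sigma x y = sigma (x 1 0) * y 0 0 + sigma (x 0 0) * y 1 0.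
Proof. by rewrite /form_h sesqui_formE !mulr0 !mulr1 add0r addr0. Qed.

Lemma form_bE x y :
  form_b sigma x y = - (sigma (x 0 0) * y 0 0) + sigma (x 1 0) * y 1 0.
Proof. by rewrite /form_b sesqui_formE !mulr0 !mulr1 add0r addr0 mulrN1 mulNr. Qed.

(** Conjugating the [sigma]-transpose of [hat g] by the Gram matrix of [h] gives
    [hat (sigmaC sigma g)]. The same happens for [b], so elements of [hatG] are isometries of both
    forms. *)
Lemma form_h_adj g x y :
  form_h sigma (hat g *m x) y = form_h sigma x (hat (sigmaC sigma g) *m y).
Proof.
rewrite !form_hE !mulmx2E !mx2E /= !linearD /= !(anti_invM hsigma) linearN /=.
rewrite !mulrDl !mulrDr !mulrA !mulrN !mulNr.
by rewrite addrACA addrC.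
Qed.

Lemma form_b_adj g x y :
  form_b sigma (hat g *m x) y = form_b sigma x (hat (sigmaC sigma g) *m y).
Proof.
rewrite !form_bE !mulmx2E !mx2E /= !linearD /= !(anti_invM hsigma) linearN /=.
rewrite !mulrDl !mulrDr !mulrA !mulrN !mulNr.
by rewrite !opprD addrACA.
Qed.

Lemma form_b_hat g x y : orthAC sigma g ->
  form_b sigma (hat g *m x) (hat g *m y) = form_b sigma x y.
Proof. by move=> Gg; rewrite form_b_adj mulmxA hat_sigmaCl ?mul1mx. Qed.

Lemma conjugate_hat g J : orthAC sigma g ->
  conjugate (hat g) J = fun x => hat g *m J (hat (sigmaC sigma g) *m x).
Proof. by move=> Gg; rewrite /conjugate inv2_hat. Qed.

Lemma conjugate_hatM g k J : orthAC sigma g -> orthAC sigma k ->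
  conjugate (hat g *m hat k) J = conjugate (hat g) (conjugate (hat k) J).
Proof.
move=> Gg Gk; rewrite -hatM !conjugate_hat //; last exact: orthACM.
by apply/funext => x; rewrite hatM sigmaCM hatM !mulmxA.
Qed.

Lemma is_matrix_group_hatG : is_matrix_group (hatG sigma).
Proof.
split; first by exists 1; [exact: orthAC1|exact: hat1].
  move=> _ _ [g Gg <-] [k Gk <-]; exists (g * k); [exact: orthACM|exact: hatM].
move=> _ [g Gg <-]; rewrite inv2_hat //; split.
- exact: hat_sigmaCr.
- exact: hat_sigmaCl.
- by exists (sigmaC sigma g) => //; exact: orthAC_sigmaC.
Qed.

(** The map [e] stands for the identity or the negation, so both eigenlines are transported by one
    argument. *)
Lemma A_line_conj g J (e : 'cV[A]_2 -> 'cV[A]_2) l : orthAC sigma g ->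
  (forall x, hat g *m e x = e (hat g *m x)) ->
  A_line l -> (forall x, l x -> J x = e x) ->
  A_line (mulmx (hat g) @` l) /\
  forall x, (mulmx (hat g) @` l) x -> conjugate (hat g) J x = e x.
Proof.
move=> Gg ge ll lJ; split.
  exact: A_line_mulmx (hat_sigmaCr Gg) (hat_sigmaCl Gg) ll.
move=> _ [x lx <-]; rewrite conjugate_hat // mulmxA hat_sigmaCl // mul1mx lJ //.
Qed.

Lemma C_G_conjugate g J : orthAC sigma g -> C_G sigma J ->
  C_G sigma (conjugate (hat g) J).
Proof.
move=> Gg [Jb [[[JD JZ] JJ [lp [lm [Alp Alm Jlp Jlm]]]] [hDl hDr hZ hsym hpos]]].
have Gg' := orthAC_sigmaC Gg.
(* The form of the conjugate is the pullback of [h_J] along the inverse of [hat g], so it inherits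
   the inner product axioms. *)
have hJ x y : form_h sigma (conjugate (hat g) J x) y =
    form_h sigma (J (hat (sigmaC sigma g) *m x)) (hat (sigmaC sigma g) *m y).
  by rewrite conjugate_hat // form_h_adj.
split=> [x y|]; first by rewrite conjugate_hat // form_b_hat // Jb form_b_hat.
split; split.
- rewrite conjugate_hat //; split=> *; first by rewrite mulmxDr JD mulmxDr.
  by rewrite /rscale mulmxA -/(rscale _ _) JZ /rscale mulmxA.
- move=> x; rewrite conjugate_hat // [hat (sigmaC _ _) *m _]mulmxA hat_sigmaCl //.
  by rewrite mul1mx JJ mulmxA hat_sigmaCr // mul1mx.
- exists (mulmx (hat g) @` lp), (mulmx (hat g) @` lm).
  have [Ap Jp] := A_line_conj (e := id) Gg (fun=> erefl) Alp Jlp.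
  have [Am Jm] := A_line_conj (e := -%R) Gg (fun x => mulmxN _ x) Alm Jlm.
  by split.
- by move=> x x' y; rewrite !hJ mulmxDr hDl.
- by move=> x y y'; rewrite !hJ mulmxDr hDr.
- by move=> x y r1 r2; rewrite !hJ /rscale !mulmxA -/(rscale _ _) hZ.
- by move=> x y; rewrite !hJ hsym.
- move=> x xreg; rewrite hJ.
  have /hpos[h1 h2] : regular_col (hat (sigmaC sigma g) *m x).
    exact: regular_col_mulmx (hat_sigmaCl Gg) (hat_sigmaCr Gg) xreg.
  split=> //; rewrite h2; split=> [e|->]; last by rewrite mulmx0.
  by rewrite -[x]mul1mx -(hat_sigmaCr Gg) -mulmxA e mulmx0.
Qed.

Lemma acts_by_conjugation_hatG : acts_by_conjugation (hatG sigma) (C_G sigma).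
Proof.
split=> [_ J [g Gg <-]|J _|_ _ J [g Gg <-] [k Gk <-] _].
- exact: C_G_conjugate.
- exact: conjugate1.
- exact: conjugate_hatM.
Qed.

Lemma J0E x : J0 x = col2 (x 1 0) (x 0 0).
Proof.
by apply: col2_eqP; rewrite mulmx2E !mx2E !mxE /= !mul1r !mul0r ?addr0 ?add0r.
Qed.

Lemma stabilizer_J0 :
  [set M | hatG sigma M /\ conjugate M J0 = J0] = hatK sigma.
Proof.
apply/seteqP; split=> M.
  move=> [[g Gg <-]]; rewrite conjugate_hat // => /funeqP eqJ.
  have {}eqJ x : hat g *m J0 x = J0 (hat g *m x).
    by have := eqJ (hat g *m x); rewrite mulmxA hat_sigmaCl ?mul1mx.
  (* On the first basis vector, the top entries of the two sides are [im_part g] and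
     [- im_part g]. *)
  have g1 : im_part g = 0.
    have /colP/(_ 0) := eqJ (col2 1 0).
    rewrite !J0E !mulmx2E !mx2E !mxE /=.
    rewrite !(mulr0, mulr1, add0r, addr0) => /eqP;
      rewrite -addr_eq0 -mulr2n -scaler_nat.
    by rewrite scaler_eq0 pnatr_eq0 => /eqP.
  have gE : g = toC (re_part g) by case: g g1 {Gg eqJ} => a b /= ->.
  exists (re_part g); last by rewrite -gE.
  move: Gg => /orthACP; rewrite gE sigmaC_toC => -[[h1 _] [h2 _]].
  move: h1 h2; rewrite /= mulr0 !subr0 => h1 h2.
  have ug : re_part g \is a GRing.unit by apply/unitrP; exists (sigma (re_part g)).
  by split=> //; rewrite -[LHS](mulrK ug) h1 mul1r.
move=> [a [ua sa] <-].
have Ga : orthAC sigma (toC a).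
  by apply/orthACP; rewrite sigmaC_toC sa; split; congr Cplx;
     rewrite /= !(mulr0, mul0r) ?subr0 ?addr0 ?mulVr ?mulrV.
split; first by exists (toC a).
rewrite conjugate_hat //; apply/funext => x.
have -> : forall y, hat (toC a) *m J0 y = J0 (hat (toC a) *m y).
  move=> y; apply: col2_eqP; rewrite !J0E !mulmx2E !mx2E !mxE /=;
    by rewrite ?mulmx2E ?mx2E /= oppr0 !mul0r ?addr0 ?add0r.
by rewrite mulmxA hat_sigmaCr ?mul1mx.
Qed.

End Action.

(* [S = mx2 p q s r] satisfies [H S H S = 1] and [S B S = B] for [H = mx2 0 1 1 0]
   and [B = mx2 (-1) 0 0 1]; comparing the two resulting inverses of [S] gives
   [H S H = B S B], which is the conclusion. *)
Lemma split_unitary_entries (S : pzRingType) (p q r s : S) :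
  p * p - q * s = 1 -> p * q = q * r -> s * s + r * p = 1 ->
  p * s + q * p = 0 -> s * r + r * q = 0 -> p * r + q * q = 1 ->
  s = - q /\ r = p.
Proof.
move=> e1 e2 e3 e4 e5 e6; split.
  rewrite -[LHS]mul1r -e1 mulrBl -[p * p * s]addr0 -(mul0r s).
  have -> : p * p * s = p * (p * s + q * p) - q * r * p.
    by rewrite mulrDr !mulrA e2 addrK.
  by rewrite e4 mulr0 sub0r mul0r addr0 -opprD -!mulrA -mulrDr addrC e3 mulr1.
rewrite -[LHS]mul1r -e1 mulrBl -mulrA.
have -> : p * r = 1 - q * q by rewrite -e6 addrK.
rewrite mulrBr mulr1 mulrA e2 -addrA -opprD -!mulrA -mulrDr addrC.
by rewrite [X in q * X]addrC e5 mulr0 oppr0 add0r.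
Qed.

(** * Membership of [J0] and transitivity *)

Section Transitivity.
Variables (R : realType) (A : falgType R) (sigma : {linear A -> A}).
Hypothesis hsigma : anti_involution sigma.
Hypothesis hherm : hermitian_pair sigma.
Hypothesis hstd : hermitian_standing sigma.
Implicit Types (p q : A) (x y : 'cV[A]_2) (J : 'cV[A]_2 -> 'cV[A]_2).

Lemma C_G_J0 : semisimple A -> C_G sigma (@J0 R A).
Proof.
move=> ss.
pose k : A := 2^-1%:A.
have kk : k + k = 1.
  by rewrite /k -scalerDl -[RHS]scale1r; congr (_ *: _); lra.
have hJ x y : form_h sigma (J0 x) y =
    sigma (x 0 0) * y 0 0 + sigma (x 1 0) * y 1 0.
  by rewrite form_hE J0E !mxE.
split=> [x y|].
  by rewrite !form_bE !J0E !mxE /= opprD opprK addrC.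
split; split.
- exact: right_linear_mulmx.
- by move=> x; apply: col2_eqP; rewrite !J0E !mxE.
(* The eigenlines of the swap; the base change matrices have inverses with entries [k] and [- k],
   where [k = 1/2]. *)
- exists (range (rscale (col2 1 1))), (range (rscale (col2 1 (-1)))); split.
  + exists (col2 1 1) => //.
    apply: (@regular_col2 _ _ 1 1 1 (-1) (mx2 k k k (- k)));
      rewrite mx2M -mx2_1; congr mx2;
      by rewrite ?(mul1r, mulr1, mulN1r, mulrN1, opprK) ?subrr ?addNr.
  + exists (col2 1 (-1)) => //.
    apply: (@regular_col2 _ _ 1 1 (-1) 1 (mx2 k (- k) k k));
      rewrite mx2M -mx2_1; congr mx2;
      by rewrite ?(mul1r, mulr1, mulN1r, mulrN1, opprK) ?subrr ?addNr.
  + by move=> _ [a _ <-]; apply: col2_eqP; rewrite J0E [LHS]mxE !rscaleE !mxE.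
  + move=> _ [a _ <-]; apply: col2_eqP;
      rewrite J0E [LHS]mxE [RHS]mxE !rscaleE !mxE /=.
      by rewrite mul1r mulN1r.
    by rewrite mul1r mulN1r opprK.
- by move=> x x' y; rewrite !hJ !mxE !linearD /= !mulrDl addrACA.
- by move=> x y y'; rewrite !hJ !mxE !mulrDr addrACA.
- by move=> x y a b; rewrite !hJ !rscaleE !(anti_invM hsigma) mulrDr mulrDl !mulrA.
- by move=> x y; rewrite !hJ linearD /= !(anti_invM hsigma) !(anti_invK hsigma).
- move=> x _; rewrite hJ.
  have n0 := nneg_sym_mul hsigma hherm hstd (x 0 0).
  have n1 := nneg_sym_mul hsigma hherm hstd (x 1 0).
  split; first exact: nneg_add.
  split=> [/(nneg_eq0 hherm n0 n1)[x0 x1]|->]; last first.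
    by rewrite !mxE !linear0 !mul0r addr0.
  by apply: col2_eqP; rewrite mxE; exact: (sym_mul_eq0 hsigma hherm hstd ss).
Qed.

(** The matrix obtained is that of [J0] times [hat (p + q i)]. Symmetry of [h_J] relates the entries
    under [sigma], its value at the first basis vector puts [p] in the cone, and the quadratic
    relations come from [b] and from [J^2 = 1]. *)
Lemma C_G_entries J : C_G sigma J -> exists p q,
  [/\ symA_nneg sigma p, sigma q = - q, p * q = q * p, p * p + q * q = 1
    & J = mulmx (mx2 (- q) p p q)].
Proof.
move=> [Jb [[Jlin JJ _] [_ _ _ hsym hpos]]].
have JE := right_linear_mx2 Jlin.
pose e0 : 'cV[A]_2 := col2 1 0; pose e1 : 'cV[A]_2 := col2 0 1.
move: JE; rewrite -/e0 -/e1.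
set s := J e0 0 0; set r := J e1 0 0; set p := J e0 1 0; set q := J e1 1 0 => JE.
have [sg0 sg1] : sigma 0 = 0 /\ sigma 1 = 1 by rewrite linear0 anti_inv1.
have psym : sigma p = p.
  have := hsym e0 e0; rewrite form_hE !mxE /= mulr1 mulr0 addr0 => ->.
  by rewrite anti_invK.
have rsym : sigma r = r.
  have := hsym e1 e1; rewrite form_hE !mxE /= mulr1 mulr0 add0r => ->.
  by rewrite anti_invK.
have sq : sigma s = q.
  have := hsym e0 e1; rewrite !form_hE !mxE /= !mulr1 !mulr0 add0r addr0 => ->.
  by rewrite anti_invK.
have pnneg : symA_nneg sigma p.
  have /hpos[+ _] : regular_col e0.
    by apply: (@regular_col2 _ _ 1 0 0 1 1%:M); rewrite mx2_1 mul1mx.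
  by rewrite form_hE !mxE /= mulr1 mulr0 addr0 -/p psym.
have E1 : p * p - q * s = 1.
  have := Jb e0 e0; rewrite !form_bE !mxE /= sg0 sg1 mul0r mulr1 addr0 opprK.
  by rewrite -/s -/p sq psym addrC.
have E2 : p * q = q * r.
  have := Jb e0 e1; rewrite !form_bE !mxE /= sg0 mul0r mulr0 addr0 !oppr0.
  by rewrite -/s -/p -/r -/q sq psym addrC => /subr0_eq.
have JJ0 := JJ e0; have JJ1 := JJ e1; rewrite !JE in JJ0 JJ1.
have E34 := (congr1 (fun v : 'cV_2 => v 0 0) JJ0,
            congr1 (fun v : 'cV_2 => v 1 0) JJ0).
have E56 := (congr1 (fun v : 'cV_2 => v 0 0) JJ1,
            congr1 (fun v : 'cV_2 => v 1 0) JJ1).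
move: E34 E56; rewrite /= !mulmx2E !mx2E !mxE /= !mulr1 !mulr0 !addr0 !add0r.
move=> [E3 E4] [E5 E6].
have [sE rE] := split_unitary_entries E1 E2 E3 E4 E5 E6.
exists p, q; split => //.
- by rewrite -[in RHS]sq sE linearN opprK.
- by move: E4; rewrite sE mulrN addrC => /subr0_eq.
- by rewrite -[X in p * X]rE.
- by apply/funext => x; rewrite JE sE rE.
Qed.

(** Some polynomial annihilating [p] has only nonnegative roots, so -1 is not one of them. *)
Lemma nneg_add1_unit p : symA_nneg sigma p -> 1 + p \is a GRing.unit.
Proof.
move=> hp.
have psym : symA sigma p.
  by case: hp => a ha <-; rewrite /symA /= expr2 anti_invM // ha.
have plim : nneg_limit sigma p.
  move=> e e0; exists (e / 2); split; [lra|lra|].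
  apply: nneg_add => //; apply: nneg_scale; [lra|exact: nneg1].
have [l [_ l0 lp]] := nneg_spectrum hsigma hherm psym plim.
have := unit_of_annihilating_poly (t := -1) lp.
rewrite scaleN1r opprK addrC; apply; rewrite root_prod_XsubC.
by apply/negP => /l0; rewrite oppr_ge0 ler10.
Qed.

Lemma C_G_orbit J : C_G sigma J ->
  exists2 g, orthAC sigma g & J = conjugate (hat g) J0.
Proof.
move=> /C_G_entries[p [q [hp qskew pq ppqq ->]]].
have [y ysym yy] : symA_nneg sigma (2 *: (1 + p)).
  by apply: nneg_scale => //; apply: nneg_add => //; exact: nneg1.
have yu : y \is a GRing.unit.
  rewrite -(unitrX_pos _ (n := 2)) // yy -mulr_algl unitrMl ?nneg_add1_unit //.
  by rewrite scaler_unit ?unitr1 // unitfE.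
have psym : sigma p = p by case: hp => a ha <-; rewrite expr2 anti_invM // ha.
have usym : sigma y^-1 = y^-1.
  by rewrite -[LHS](mulrK yu) -{2}ysym -anti_invM // mulrV // anti_inv1 // mul1r.
have y2 : (1 + p) * (1 + p) + q * q = y ^+ 2.
  rewrite yy mulrDl !mulrDr !mulr1 mul1r -addrA -(addrA p) ppqq.
  by rewrite [p + 1]addrC scaler_nat mulr2n.
(* This is [(1 + conj s) y^-1] for [s = p + q i]. *)
pose g := Cplx ((1 + p) * y^-1) (- (q * y^-1)).
have sgE : sigmaC sigma g = Cplx (y^-1 * (1 + p)) (y^-1 * q).
  rewrite /g /sigmaC /= linearN !(anti_invM hsigma) linearD /= usym psym qskew.
  by rewrite (anti_inv1 hsigma) mulrN opprK.
(* [y] is an arbitrary symmetric root, so commutation with [p] and [q] is derived only for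
   [y^2 = 2 + 2p] and its inverse. *)
have y2p : y ^+ 2 * p = p * y ^+ 2.
  by rewrite yy -scalerAl -scalerAr mulrDl mulrDr mul1r mulr1.
have y2q : y ^+ 2 * q = q * y ^+ 2.
  by rewrite yy -scalerAl -scalerAr mulrDl mulrDr mul1r mulr1 pq.
have pq1 : (1 + p) * q = q * (1 + p) by rewrite mulrDl mulrDr mul1r mulr1 pq.
have y2p1 : y ^+ 2 * (1 + p) = (1 + p) * y ^+ 2.
  by rewrite mulrDl mulrDr mul1r mulr1 y2p.
have comm_inv a : y ^+ 2 * a = a * y ^+ 2 ->
    a * (y^-1 * y^-1) = (y^-1 * y^-1) * a.
  by move=> ya; rewrite -expr2 exprVn; apply: commrV.
have Gg : orthAC sigma g.
  apply/orthACP; rewrite sgE; split; congr Cplx => /=.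
  - rewrite mulrN opprK !mulrA -mulrDl -!(mulrA y^-1) -mulrDr y2.
    by rewrite expr2 !mulrA mulVr // mul1r mulrV.
  - rewrite mulrN !mulrA -mulNr -mulrDl -!(mulrA y^-1) -mulrN -mulrDr.
    by rewrite pq1 addNr mulr0 mul0r.
  - rewrite mulNr opprK -!mulrA !(mulrA y^-1) !mulrA -(mulrA (1 + p)) -(mulrA q).
    rewrite !comm_inv //.
    by rewrite -!mulrA -mulrDr -mulrDr y2 expr2 mulKr // mulVr.
  - rewrite mulNr !mulrA -(mulrA (1 + p)) -(mulrA q).
    rewrite !comm_inv //.
    by rewrite -!mulrA pq1 subrr.
(* Together with [qE], the real and imaginary parts of [s (1 + conj s) = 1 + s], that is, of
   [s g = conj g] before multiplying by [y^-1]. *)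
have pE : p * (1 + p) + q * q = 1 + p.
  by rewrite mulrDr mulr1 -addrA ppqq addrC.
have qE : q * (1 + p) - p * q = q by rewrite mulrDr mulr1 pq addrK.
exists g => //; rewrite (conjugate_hat _ Gg); apply/funext => x.
(* Inserting [hat g] times its inverse reduces the goal to a matrix identity, [J] times [hat g]
   equals [hat g] times [J0]. *)
rewrite -[x in LHS]mul1mx -(hat_sigmaCr Gg) -mulmxA /J0 !mulmxA.
congr (_ *m _ *m _); rewrite !mx2M; congr mx2 => /=;
  rewrite !(mulr0, mulr1, addr0, add0r, mulrN, mulNr, opprK) !mulrA.
- by rewrite addrC -opprB -mulrBl qE.
- by rewrite -mulrDl addrC pE.
- by rewrite -mulrDl pE.
- by rewrite addrC -mulrBl qE.
Qed.

End Transitivity.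

Theorem theorem5p2 (R : realType) (A : falgType R) (sigma : {linear A -> A})
    (hA : semisimple A) (hsigma : anti_involution sigma)
    (hherm : hermitian_pair sigma) (hstd : hermitian_standing sigma) :
  [/\ is_matrix_group (hatG sigma),
      acts_by_conjugation (hatG sigma) (C_G sigma),
      (forall J J' : 'cV[A]_2 -> 'cV[A]_2, C_G sigma J -> C_G sigma J' ->
         exists2 M, hatG sigma M & conjugate M J = J'),
      C_G sigma J0 &
      [set M | hatG sigma M /\ conjugate M J0 = J0] = hatK sigma].
Proof.
split.
- exact: is_matrix_group_hatG.
- exact: acts_by_conjugation_hatG.
- move=> J J' /(C_G_orbit hsigma hherm hstd)[g Gg ->].
  move=> /(C_G_orbit hsigma hherm hstd)[g' Gg' ->].
  have Gg1 := orthAC_sigmaC hsigma Gg.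
  (* Since [sigmaC sigma g] is the inverse of [g], this goes from [J] back to [J0] and on to
     [J']. *)
  exists (hat g' *m hat (sigmaC sigma g)).
    exists (g' * sigmaC sigma g); [exact: orthACM|exact: hatM].
  rewrite (conjugate_hatM hsigma) //; congr conjugate.
  by rewrite -(conjugate_hatM hsigma) // hat_sigmaCl // conjugate1.
- exact: C_G_J0.
- exact: stabilizer_J0.
Qed.
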